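(* Let $P\in\mathcal{L}(n)$. Then $P$ admits a strongly generic coordinatization if and only if $P$ is a graded finite atomic lattice of rank $n$, i.e. every maximal chain of $P$ has length $n$ (has $n+1$ elements).
   Context: A finite atomic lattice is a finite lattice (with minimum $\hat 0$, maximum $\hat 1$) in which every element other than $\hat 0$ is a join of atoms, an atom being an element covering $\hat 0$. $\mathcal{L}(n)$ is the set of all finite atomic lattices with $n$ ordered atoms. For $x\in P$ put $\lceil x\rceil=\{a\in P : x\le a\}$ and $\lceil x\rceil^c=P\setminus\lceil x\rceil$. A labeling of $P$ is a family $\mathcal{M}=\{m_p\}_{p\in P}$ of monomials in a polynomial ring in finitely many variables over a field ($m_p=1$ meaning $p$ is unlabeled). $M_{P,\mathcal{M}}$ is the monomial ideal generated by the monomials $x(a)=\prod_{p\in\lceil a\rceil^c}m_p$ for the atoms $a$ of $P$. The LCM lattice of a monomial ideal is the set of least common multiples of all subsets of its minimal monomial generators (with $1$ the lcm of the empty set), ordered by divisibility. The labeling $\mathcal{M}$ is a coordinatization of $P$ if the LCM lattice of $M_{P,\mathcal{M}}$ is isomorphic to $P$. A monomial ideal is strongly generic if no variable appears with the same (nonzero) exponent in two or more of its minimal generators. A coordinatization is strongly generic if its monomial ideal $M_{P,\mathcal{M}}$ is strongly generic. *)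

(* Defs.v *)
From HB Require Import structures.
From mathcomp Require Import all_boot all_order all_algebra finmap.
From mathcomp.multinomials Require Import mpoly.

Set Implicit Arguments.
Unset Strict Implicit.
Unset Printing Implicit Defensive.

Import Order.TTheory GRing.Theory.

Section AtomicLattices.
Context {d : Order.disp_t} (P : finTBLatticeType d).

Local Open Scope order_scope.

Definition covers (x y : P) : bool :=
  (x < y) && [forall z, ~~ ((x < z) && (z < y))].

Definition atom : pred P := covers \bot.

Definition atomic : Prop :=
  forall x : P, x != \bot ->
    exists2 S : {set P}, {subset S <= atom} & x = \join_(a in S) a.

(* The elements of L(n) are the pairs (P, s) with this property: the tuple s
   lists the atoms of P, in the chosen order and without repetition. *)
Definition in_L (n : nat) (s : n.-tuple P) : Prop :=
  [/\ atomic, uniq s & s =i atom].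

Definition is_chain (C : {set P}) : bool :=
  [forall x in C, forall y in C, (x <= y) || (y <= x)].

Definition maximal_chain (C : {set P}) : bool := maxset is_chain C.

Definition graded_of_rank (n : nat) : Prop :=
  forall C : {set P}, maximal_chain C -> #|C| = n.+1.

End AtomicLattices.

(* A monomial is represented by its exponent vector: products of monomials are
   sums, the monomial 1 is 0, and divisibility is the pointwise order (_ <= _)%MM
   (not the total monomial order (_ <= _)%O). *)
Section MonomialIdeals.
Context (K : fieldType) {k : nat}.

Local Open Scope ring_scope.

Implicit Types (I : {mpoly K[k]} -> Prop) (G : {fset 'X_{1..k}}).

Definition monomial_ideal G (p : {mpoly K[k]}) : Prop :=
  exists c : 'X_{1..k} -> {mpoly K[k]}, p = (\sum_(u <- G) c u * 'X_[u]).

Definition generates G I : Prop := forall p, I p <-> monomial_ideal G p.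

Definition minimal_generators I G : Prop :=
  generates G I /\ forall H : {fset 'X_{1..k}}, (H `<` G)%fset -> ~ generates H I.

Definition strongly_generic I : Prop :=
  exists2 G, minimal_generators I G &
    {in G &, forall u v : 'X_{1..k}, u != v ->
       forall i : 'I_k, u i != 0%N -> u i != v i}.

Definition lcms G : {fset 'X_{1..k}} :=
  [fset \big[@mlcm k/0%MM]_(u <- S : {fset 'X_{1..k}}) u | S in fpowerset G]%fset.

Lemma monomial_ideal_dvd G u :
  monomial_ideal G 'X_[u] <-> exists2 g, g \in G & (g <= u)%MM.
Proof.
split=> [[c /(congr1 (mcoeff u))]|[g gG gu]].
  rewrite mcoeffX eqxx raddf_sum /= => E.
  have [/hasP[g gG nz]|/hasPn none] :=
    boolP (has (fun g => (c g * 'X_[g])@_u != 0) G).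
    exists g => //; move: nz; rewrite mcoeff_eq0 negbK (perm_mem (msuppMX _ _)).
    by case/mapP=> m _ ->; apply: lem_addr.
  move: E; rewrite big1_seq => [/eqP|g /andP[_ /none]]; first by rewrite oner_eq0.
  by rewrite negbK => /eqP.
exists (fun v => if v == g then 'X_[(u - g)%MM] else 0%R).
rewrite (big_fsetD1 g) //= eqxx -mpolyXD submK // big1_seq ?addr0 // => v.
by case/andP=> _; rewrite in_fsetD1 => /andP[/negbTE-> _]; rewrite mul0r.
Qed.

Lemma generates_sub G H :
  (forall g, g \in G -> exists2 h, h \in H & (h <= g)%MM) ->
  forall p, monomial_ideal G p -> monomial_ideal H p.
Proof.
move=> GH p [c ->].
have add q r : monomial_ideal H q -> monomial_ideal H r ->
    monomial_ideal H (q + r).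
  move=> [a ->] [b ->]; exists (fun v => a v + b v).
  by rewrite -big_split; apply: eq_bigr => v _; rewrite mulrDl.
rewrite big_seq; elim/big_ind: _ => // [|g /GH hg].
  by exists (fun=> 0%R); rewrite big1 // => v _; rewrite mul0r.
have [b ->] := (monomial_ideal_dvd H g).2 hg.
exists (fun v => c g * b v)%R; rewrite big_distrr /=.
by apply: eq_bigr => v _; rewrite mulrA.
Qed.

Lemma minimal_generators_unique I G H :
  minimal_generators I G -> minimal_generators I H -> G = H.
Proof.
suff sub : forall G H, minimal_generators I G -> minimal_generators I H ->
    (G `<=` H)%fset.
  by move=> mG mH; apply/eqP; rewrite eqEfsubset !sub.
move=> {}G {}H [gG mG] [gH _]; apply/fsubsetP => u uG.
have dvd A B v : generates A I -> generates B I -> v \in A ->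
    exists2 w, w \in B & (w <= v)%MM.
  move=> gA gB vA; apply/monomial_ideal_dvd/gB/gA/monomial_ideal_dvd.
  by exists v; rewrite ?lepm_refl.
have [h hH hu] := dvd _ _ _ gG gH uG.
have [g gGin gh] := dvd _ _ _ gH gG hH.
have [gu|ne] := eqVneq g u.
  suff -> : u = h by [].
  by apply/mnmP=> i; apply/eqP; rewrite eqn_leq (mnm_lepP hu) -{1}gu (mnm_lepP gh).
case: (mG (G `\ u)%fset); first by rewrite fproperD1.
move=> p; split=> [/gG|]; last first.
  by move=> q; apply/gG; apply: generates_sub q => v /fsetD1P[_ vG]; exists v; rewrite ?lepm_refl.
apply: generates_sub => v vG; have [->|nv] := eqVneq v u.
  by exists g; [rewrite in_fsetD1 ne|apply: lepm_trans gh hu].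
by exists v; rewrite ?lepm_refl // in_fsetD1 nv.
Qed.

End MonomialIdeals.

Section Coordinatizations.
Context (K : fieldType) {d : Order.disp_t} {P : finTBLatticeType d} {k : nat}.
Implicit Types (M : P -> 'X_{1..k}) (L : {fset 'X_{1..k}}).

Definition atom_monomial M (a : P) : 'X_{1..k} :=
  (\big[+%MM/0%MM]_(p | ~~ (a <= p)%O) M p)%MM.

Definition labeling_ideal M : {mpoly K[k]} -> Prop :=
  monomial_ideal (K := K) [fset atom_monomial M a | a in @atom d P]%fset.

Definition iso_under_divisibility L : Prop :=
  exists f : P -> 'X_{1..k},
    (forall x y, (f x <= f y)%MM = (x <= y)%O) /\
    (forall u, u \in L <-> exists x, f x = u).

Definition coordinatization M : Prop :=
  exists2 G, minimal_generators (labeling_ideal M) G &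
    iso_under_divisibility (lcms G).

Definition strongly_generic_coordinatization M : Prop :=
  coordinatization M /\ strongly_generic (labeling_ideal M).

End Coordinatizations.

(* Main.v *)
Require Import Defs.
From mathcomp Require Import all_boot all_order all_algebra finmap.
From mathcomp.multinomials Require Import mpoly.

Set Implicit Arguments.
Unset Strict Implicit.
Unset Printing Implicit Defensive.

Import Order.TTheory.

(** For a maximal chain C of P and an element x, let entry C x be the number of
    elements of C that do not lie above x: climbing C from the bottom, this is
    the moment at which the chain gets above x. The elements of C not above x
    form an initial segment of C, so entry C turns joins into maxima. Everything
    rests on a counting criterion ([maximal_chain_card]): in an atomic lattice, a
    maximal chain has one element more than there are atoms if and only if no
    two atoms have the same entry in it. So P is graded of rank n exactly
    when every maximal chain tells all the atoms apart.

    Suppose that P is isomorphic to the lcm lattice of a strongly generic ideal,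
    and that the atoms a and b enter a maximal chain C at the same time. Let x be
    the last element of C not above a. By maximality of C, the joins of x with a
    and with b are both the next element of C, hence are equal
    ([entry_eq_join]). In terms of monomials, lcm(a, x) = lcm(b, x). A variable
    whose exponent in a exceeds the one in x would have the same nonzero exponent
    in a and in b, against strong genericity; so a divides x, a contradiction
    ([strongly_generic_entry_inj]).

    Conversely, take one variable for each maximal chain, and label p with the
    product of the variables of the chains through p. The exponent of the
    variable of C in the generator x(a) is then entry C a. The map sending x to
    the vector of all entry C x sends joins to lcms; it is an order embedding,
    because if x is not below y then x enters strictly later than y in any
    maximal chain through y. Hence this labeling is a coordinatization of any
    atomic lattice, and it is strongly generic as soon as the entries of the
    atoms in each maximal chain are distinct, which is the case when P is graded
    of rank n. *)

(** * Atoms and maximal chains in an atomic lattice *)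

Section Chains.
Context {d : Order.disp_t} {P : finTBLatticeType d}.
Local Open Scope order_scope.
Implicit Types (C B : {set P}) (x y p q a b : P).

Lemma atom_neq_bot a : atom a -> a != \bot.
Proof. by case/andP=> /gt_eqF ->. Qed.

Lemma le_atom a z : atom a -> z <= a -> z = \bot \/ z = a.
Proof.
case/andP=> _ /forallP/(_ z) nz; rewrite le_eqVlt => /predU1P[-> |za].
  by right.
by left; move: nz; rewrite za andbT lt0x negbK => /eqP.
Qed.

Lemma atoms_antichain a b : atom a -> atom b -> a <= b -> a = b.
Proof. by move=> /atom_neq_bot/eqP aN ab /(le_atom ab)[]. Qed.

Lemma atomic_le x y :
  atomic P -> (forall a, atom a -> a <= x -> a <= y) -> x <= y.
Proof.
move=> atP xy; have [->|/atP[S Satom xE]] := eqVneq x \bot; first exact: le0x.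
rewrite {1}xE; apply/joinsP => a aS; apply: xy; first exact: Satom.
by rewrite xE; apply: joins_sup.
Qed.

Lemma is_chainP C :
  reflect {in C &, forall p q, (p <= q) || (q <= p)} (is_chain C).
Proof.
by apply: (iffP 'forall_in_forall_inP) => h p q;
  [move=> /h/(_ q)|move=> *; apply: h].
Qed.

Lemma maximal_chain_mem C x :
  maximal_chain C -> {in C, forall p, (x <= p) || (p <= x)} -> x \in C.
Proof.
case/maxsetP=> /is_chainP chC maxC xC.
rewrite -(maxC (x |: C)) ?setU11 ?subsetUr //; apply/is_chainP => p q.
case/setU1P=> [->|pC] /setU1P[->|qC]; first by rewrite lexx.
- exact: xC.
- by rewrite orbC xC.
- exact: chC.
Qed.

Lemma maximal_chain_exists y : exists2 C, maximal_chain C & y \in C.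
Proof.
have /maxset_exists[C mC yC] : is_chain [set y].
  by apply/is_chainP => p q /set1P-> /set1P->; rewrite lexx.
by exists C => //; apply: (subsetP yC); rewrite set11.
Qed.

(** * The entry of an element into a chain *)

Definition below_entry C x : {set P} := [set p in C | ~~ (x <= p)].
Definition entry C x : nat := #|below_entry C x|.

(** Both sets are initial segments of the chain C; this is what makes the number
    entry C x determine the set below_entry C x, and turns joins into maxima. *)
Lemma below_entry_nested C x y : is_chain C ->
  (below_entry C x \subset below_entry C y)
    || (below_entry C y \subset below_entry C x).
Proof.
move/is_chainP=> chC; apply: contraT; rewrite negb_or.
case/andP=> /subsetPn[p] + + /subsetPn[q].
rewrite !inE => /andP[pC xp]; rewrite pC negbK => yp /andP[qC yq].
rewrite qC negbK => xq; case/orP: (chC p q pC qC) => [pq|qp].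
  by rewrite (le_trans yp pq) in yq.
by rewrite (le_trans xq qp) in xp.
Qed.

Lemma entry_inj C x y : is_chain C -> entry C x = entry C y ->
  below_entry C x = below_entry C y.
Proof.
rewrite /entry => chC exy.
have [s|s] := orP (below_entry_nested x y chC); [|apply/esym];
  by apply/eqP; rewrite eqEcard s exy leqnn.
Qed.

Lemma entry_le C x y : x <= y -> (entry C x <= entry C y)%N.
Proof.
move=> xy; apply/subset_leq_card/subsetP => p; rewrite !inE => /andP[-> xp].
by apply: contra xp; apply: le_trans.
Qed.

Lemma entry_join C x y :
  is_chain C -> entry C (x `|` y) = maxn (entry C x) (entry C y).
Proof.
move=> chC; rewrite /entry.
have -> : below_entry C (x `|` y) = below_entry C x :|: below_entry C y.
  by apply/setP=> p; rewrite !inE leUx negb_and andb_orr.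
have [s|s] := orP (below_entry_nested x y chC).
  by rewrite (setUidPr s); apply/esym/maxn_idPr/subset_leq_card.
by rewrite (setUidPl s); apply/esym/maxn_idPl/subset_leq_card.
Qed.

Lemma entry_bot C : entry C \bot = 0%N.
Proof.
by apply/eqP; rewrite cards_eq0; apply/eqP/setP=> p; rewrite !inE le0x andbF.
Qed.

(** The element y itself is counted by entry C x, but not by entry C y. *)
Lemma entry_lt C x y :
  is_chain C -> y \in C -> ~~ (x <= y) -> (entry C y < entry C x)%N.
Proof.
move/is_chainP=> chC yC xy; apply/proper_card/properP; split.
  apply/subsetP=> p; rewrite !inE => /andP[pC yp]; rewrite pC.
  have := chC _ _ yC pC; rewrite (negPf yp) /= => py.
  by apply: contra xy => /le_trans; apply.
by exists y; rewrite !inE ?yC ?lexx.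
Qed.

(** If each strict step p < q of C captures a new element of B, then the number
    of elements of B below p increases strictly along C; it takes at most
    #|B| + 1 values. *)
Lemma card_chain_le C B : is_chain C ->
    {in C &, forall p q, p < q ->
       exists2 c, c \in B & ~~ (c <= p) && (c <= q)} ->
  (#|C| <= #|B|.+1)%N.
Proof.
move/is_chainP=> chC sepC; pose w p := #|[set c in B | c <= p]|.
have wlt : {in C &, forall p q, p < q -> (w p < w q)%N}.
  move=> p q pC qC pq; have [c cB /andP[cp cq]] := sepC p q pC qC pq.
  apply/proper_card/properP; split; last by exists c; rewrite !inE cB ?cq.
  by apply/subsetP=> e; rewrite !inE => /andP[-> /le_trans]; apply; apply: ltW.
pose v p : 'I_#|B|.+1 := inord (w p).
have vE p : v p = w p :> nat.
  rewrite inordK // ltnS subset_leq_card //.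
  by apply/subsetP=> c; rewrite inE => /andP[].
suff inj : {in C &, injective v}.
  by rewrite -(card_in_imset inj) -[X in (_ <= X)%N]card_ord max_card.
move=> p q pC qC /(congr1 val); rewrite /= !vE => wpq.
case/orP: (chC p q pC qC); rewrite le_eqVlt => /predU1P[//|] /wlt.
  by rewrite wpq ltnn => /(_ pC qC).
by rewrite wpq ltnn => /(_ qC pC).
Qed.

(** If two atoms a and b enter C together, then b can be left out of the atoms
    that witness the strict steps of C, since a witnesses the same steps; by
    [card_chain_le], C is then too short. Conversely, entry C takes its values
    on the bottom and the atoms in [0, #|C| - 1], is 0 only at the bottom, and so
    injectivity on atoms forces C to be long enough. *)
Lemma maximal_chain_card C : atomic P -> maximal_chain C ->
  #|C| = #|@atom d P|.+1 <-> {in @atom d P &, injective (entry C)}.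
Proof.
move=> atP mC; have [chC _] := maxsetP mC.
have sep p q : p < q -> exists2 c, atom c & ~~ (c <= p) && (c <= q).
  move=> pq; suff /existsP[c /andP[? ?]] :
      [exists c, atom c && (~~ (c <= p) && (c <= q))] by exists c.
  apply: contraT => /existsPn h; have : q <= p; last by rewrite lt_geF.
  apply: atomic_le => // a aa aq; move: (h a); rewrite aa aq andbT /=.
  by rewrite negbK.
split=> [cardC a b aa ab eab|inj].
  apply/eqP; apply: contraT => nab.
  suff : (#|C| <= #|[set c | atom c] :\ b|.+1)%N.
    rewrite cardC -[#|@atom d P|]cardsE (cardsD1 b [set c in @atom d P]) inE.
    by rewrite ab ltnn.
  apply: card_chain_le => // p q pC qC /sep[c ac cpq].
  have [cb|ncb] := eqVneq c b; last by exists c => //; rewrite !inE ncb.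
  exists a; first by rewrite !inE nab.
  move/setP: (entry_inj chC eab) => E; move: (E p) (E q); rewrite !inE pC qC /=.
  by move=> -> /negb_inj->; rewrite -cb.
apply/eqP; rewrite eqn_leq; apply/andP; split.
  rewrite -[#|@atom d P|]cardsE.
  apply: card_chain_le => // p q _ _ /sep[c ac cpq].
  by exists c; rewrite ?inE.
have topC : \top \in C by apply: maximal_chain_mem => // p _; rewrite lex1 orbT.
have elt x : (entry C x < #|C|)%N.
  rewrite [ltnRHS](cardsD1 \top) topC ltnS subset_leq_card //.
  apply/subsetP=> p; rewrite !inE => /andP[-> xp]; rewrite andbT.
  by apply: contraNneq xp => ->; rewrite lex1.
have botC : \bot \in C by apply: maximal_chain_mem => // p _; rewrite le0x.
have egt a : atom a -> (0 < entry C a)%N.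
  move=> aa; rewrite -(entry_bot C) entry_lt //.
  by rewrite lex0 atom_neq_bot.
have injb :
    {in \bot |: [set a | atom a] &, injective (fun x => Ordinal (elt x))}.
  move=> x y; rewrite !inE => + + /(congr1 val) /=.
  case/predU1P=> [->|ax] /predU1P[->|ay] //.
  - by rewrite entry_bot => E; have := egt _ ay; rewrite -E.
  - by rewrite entry_bot => E; have := egt _ ax; rewrite E.
  - exact: inj.
have -> : #|@atom d P|.+1 = #|(\bot : P) |: [set a : P | atom a]|.
  rewrite cardsU1 inE cardsE.
  by case: (boolP (atom \bot)) => // /atom_neq_bot; rewrite eqxx.
by rewrite -(card_in_imset injb) -[X in (_ <= X)%N]card_ord max_card.
Qed.

(** The witness x is the last element of C not above a. By maximality of C,
    the joins of x with a and with b belong to C, and both must be the element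
    that follows x in C. *)
Lemma entry_eq_join C a b : maximal_chain C -> a != \bot ->
  entry C a = entry C b -> exists2 x, ~~ (a <= x) & a `|` x = b `|` x.
Proof.
move=> mC a0 eab; have [chC _] := maxsetP mC; have chP := is_chainP _ chC.
have Uab := entry_inj chC eab; set U := below_entry C a in Uab.
have botU : \bot \in U.
  by rewrite inE lex0 a0 andbT maximal_chain_mem // => p _; rewrite le0x.
pose x := \join_(p in U) p.
have xU : x \in U.
  apply: (big_ind (fun z => z \in U)) => // p q pU qU.
  have [pC qC] : p \in C /\ q \in C.
    by move: pU qU; rewrite !inE => /andP[-> _] /andP[-> _].
  by case/orP: (chP p q pC qC) => [/join_idPl|/join_idPr]; rewrite joinC => ->.
have [xC ax] : x \in C /\ ~~ (a <= x) by move: xU; rewrite inE => /andP[].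
have inC c : below_entry C c = U -> c `|` x \in C.
  move=> cU; apply: maximal_chain_mem => // p pC.
  have [cp|cp] := boolP (c <= p).
    rewrite leUx cp /=; case/orP: (chP _ _ xC pC) => [->//|px].
    by move: xU; rewrite -cU inE (le_trans cp px) andbF.
  have pU : p \in U by rewrite -cU inE pC.
  by rewrite [X in _ || X](le_trans (joins_sup _ pU) (leUr _ _)) orbT.
(* Otherwise e `|` x, an element of C not above c, would lie in U, whose
   elements are not above e. *)
have le c e : below_entry C c = U -> below_entry C e = U -> c `|` x <= e `|` x.
  move=> cU eU; rewrite leUx leUr andbT; apply: contraTT (leUr x e) => ce.
  have : e `|` x \in U by rewrite -cU inE ce inC.
  by rewrite -eU inE leUl andbF.
by exists x => //; apply/le_anti; rewrite !le.
Qed.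

End Chains.

(** * Lcm lattices and minimal generators *)

Section LcmSets.
Context {k : nat}.
Implicit Types (G S : {fset 'X_{1..k}}) (u v w : 'X_{1..k}).

Lemma lepm_anti u v : (u <= v)%MM -> (v <= u)%MM -> u = v.
Proof.
move=> /mnm_lepP uv /mnm_lepP vu.
by apply/mnmP=> i; apply/eqP; rewrite eqn_leq uv vu.
Qed.

Lemma biglcm_leP (r : seq 'X_{1..k}) w :
  reflect (forall u, u \in r -> (u <= w)%MM)
          (\big[@mlcm k/0%MM]_(u <- r) u <= w)%MM.
Proof.
have -> : (\big[@mlcm k/0%MM]_(u <- r) u <= w)%MM
          = all (fun u => (u <= w)%MM) r.
  elim: r => [|u r IH]; last by rewrite big_cons lem_mlcm IH.
  by rewrite big_nil; apply/mnm_lepP=> i; rewrite mnm0E.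
exact: allP.
Qed.

Lemma biglcm_eq (r : seq 'X_{1..k}) w :
  (forall v, (w <= v)%MM <-> (forall u, u \in r -> (u <= v)%MM)) ->
  w = \big[@mlcm k/0%MM]_(u <- r) u.
Proof.
move=> wP; apply: lepm_anti; first exact/wP/biglcm_leP/lepm_refl.
exact/biglcm_leP/wP/lepm_refl.
Qed.

Lemma lcmsP G w :
  reflect (exists2 S, (S `<=` G)%fset & w = \big[@mlcm k/0%MM]_(u <- S) u)
          (w \in lcms G).
Proof.
apply: (iffP (imfsetP _ _ _ _)) => -[S SG ->]; exists S => //;
  by move: SG; rewrite /= fpowersetE.
Qed.

Lemma lcms0 G : 0%MM \in lcms G.
Proof.
apply/lcmsP; exists fset0; rewrite ?fsub0set //; apply: biglcm_eq => v.
by split=> // _; apply/mnm_lepP=> i; rewrite mnm0E.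
Qed.

Lemma lcms_gen G g : g \in G -> g \in lcms G.
Proof.
move=> gG; apply/lcmsP; exists [fset g]%fset; rewrite ?fsub1set //.
by apply: biglcm_eq => v; split=> [? u /fset1P->|] //; apply; rewrite fset11.
Qed.

Lemma lcms_mlcm G u v : u \in lcms G -> v \in lcms G -> mlcm u v \in lcms G.
Proof.
move=> /lcmsP[S SG ->] /lcmsP[T TG ->]; apply/lcmsP.
exists (S `|` T)%fset; first by rewrite fsubUset SG.
apply: biglcm_eq => w; rewrite lem_mlcm; split=> [|Uw].
  by case/andP=> /biglcm_leP Sw /biglcm_leP Tw z /fsetUP[/Sw|/Tw].
by apply/andP; split; apply/biglcm_leP=> z zS; apply: Uw;
  rewrite in_fsetU zS ?orbT.
Qed.

Lemma lcms_ind G (Q : 'X_{1..k} -> Prop) :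
  Q 0%MM -> (forall u v, Q u -> Q v -> Q (mlcm u v)) ->
  (forall g, g \in G -> Q g) ->
  forall u, u \in lcms G -> Q u.
Proof.
move=> Q0 QU QG u /lcmsP[S SG ->].
by rewrite big_seq; elim/big_ind: _ => // g gS; apply/QG/(fsubsetP SG).
Qed.

(** A monomial lies in a monomial ideal only if some generator divides it, so in
    an antichain no generator can be recovered from the others. *)
Lemma antichain_minimal_generators (K : fieldType) G :
  {in G &, forall u v, (u <= v)%MM -> u = v} ->
  minimal_generators (monomial_ideal (K := K) G) G.
Proof.
move=> antiG; split=> [p //|H HG genH].
have [/fsubsetP sHG /fsubsetPn[u uG uH]] := andP HG.
have [h hH hu] : exists2 h, h \in H & (h <= u)%MM.
  apply/(monomial_ideal_dvd K)/genH/monomial_ideal_dvd.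
  by exists u; rewrite ?lepm_refl.
by move: uH; rewrite -(antiG _ _ (sHG _ hH) uG hu) hH.
Qed.

End LcmSets.

(** * Strong genericity separates the atoms along maximal chains *)

Section FromIso.
Context {d : Order.disp_t} {P : finTBLatticeType d}.
Implicit Types (x y a b : P) (C : {set P}).
Context {k : nat} (G : {fset 'X_{1..k}}) (f : P -> 'X_{1..k}).
Context (fle : forall x y, (f x <= f y)%MM = (x <= y)%O)
  (fG : forall u, u \in lcms G <-> exists x, f x = u).

Lemma iso_join x y : f (x `|` y)%O = mlcm (f x) (f y).
Proof.
have [z fz] : exists z, f z = mlcm (f x) (f y).
  by apply/fG/lcms_mlcm; apply/fG; [exists x|exists y].
apply: lepm_anti; last by rewrite lem_mlcm !fle leUl leUr.
by rewrite -fz fle leUx -!fle fz lem_mlcml lem_mlcmr.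
Qed.

(** The monomial f a is the lcm of generators that are images of elements below
    a, that is of a or of the bottom; if all came from the bottom, f a would
    divide f \bot. *)
Lemma iso_atom a : atom a -> f a \in G.
Proof.
move=> aa; have /lcmsP[S SG faE] : f a \in lcms G by apply/fG; exists a.
apply: contraT => faG; case/eqP: (atom_neq_bot aa); apply/eqP.
rewrite -lex0 -fle [X in (X <= _)%MM]faE; apply/biglcm_leP=> u uS.
have uG := fsubsetP SG _ uS; have /fG[z fz] := lcms_gen uG.
have : (z <= a)%O.
  rewrite -fle [X in (_ <= X)%MM]faE fz.
  by move: u uS {uG fz}; apply/biglcm_leP/lepm_refl.
case/(le_atom aa) => zE; first by rewrite -fz zE lepm_refl.
by rewrite -zE fz uG in faG.
Qed.

(** A variable i with f x i < f a i has, by the equality of the lcms of f x with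
    f a and with f b, the exponent f a i > 0 in both generators f a and f b. *)
Lemma strongly_generic_entry_inj C :
  {in G &, forall u v : 'X_{1..k}, u != v ->
     forall i : 'I_k, u i != 0%N -> u i != v i} ->
  maximal_chain C -> {in @atom d P &, injective (entry C)}.
Proof.
move=> sgG mC a b aa ab eab; apply/eqP; apply: contraT => nab.
have [x ax /(congr1 f)] := entry_eq_join mC (atom_neq_bot aa) eab.
rewrite !iso_join => /mnmP abx; case/negP: ax; rewrite -fle; apply/mnm_lepP=> i.
have fab : f a != f b.
  by apply: contraNneq nab => fE; apply/eqP/le_anti; rewrite -!fle fE lepm_refl.
rewrite leqNgt; apply/negP => xa.
have /eqP[] : f a i != f b i.
  apply: (sgG _ _ (iso_atom aa) (iso_atom ab) fab).
  by rewrite -lt0n (leq_ltn_trans _ xa).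
move: (abx i); rewrite !mnmE (maxn_idPl (ltnW xa)) => E.
by move: xa; rewrite E; case: (leqP (f b i) (f x i)) => //; rewrite ltnn.
Qed.

End FromIso.

(** * A labeling with one variable per maximal chain *)

Section ToIso.
Context {d : Order.disp_t} {P : finTBLatticeType d}.
Implicit Types (x y a b : P).
Context {k : nat} (f : P -> 'X_{1..k}).
Context (fle : forall x y, (f x <= f y)%MM = (x <= y)%O)
  (f0 : f \bot%O = 0%MM) (fU : forall x y, f (x `|` y)%O = mlcm (f x) (f y)).

(** Atomicity is what makes every f x an lcm of the monomials f a of atoms. *)
Lemma iso_lcms_atoms : atomic P ->
  iso_under_divisibility (P := P) (lcms [fset f a | a in @atom d P]%fset).
Proof.
move=> atP; exists f; split=> // u; split=> [|[x <-]].
  move: u; apply: lcms_ind => [|_ _ [x <-] [y <-]|g /imfsetP[a _ ->]].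
  - by exists \bot%O.
  - by exists (x `|` y)%O; rewrite fU.
  - by exists a.
have [->|/atP[S Satom ->]] := eqVneq x \bot%O; first by rewrite f0 lcms0.
elim/big_ind: _ => [|p q fp fq|a /Satom aS]; first by rewrite f0 lcms0.
  by rewrite fU lcms_mlcm.
by apply: lcms_gen; apply: in_imfset.
Qed.

Lemma atoms_minimal_generators (K : fieldType) :
  minimal_generators (monomial_ideal (K := K) [fset f a | a in @atom d P]%fset)
    [fset f a | a in @atom d P]%fset.
Proof.
apply: antichain_minimal_generators => _ _ /imfsetP[a aa ->] /imfsetP[b ab ->].
by rewrite fle => /(atoms_antichain aa ab)->.
Qed.

End ToIso.

Section ChainLabeling.
Context (K : fieldType) {d : Order.disp_t} {P : finTBLatticeType d}.
Implicit Types (x y p a : P).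

Let chains := [set C : {set P} | maximal_chain C].

Definition chain_labeling p : 'X_{1..#|chains|} :=
  [multinom (p \in enum_val i : nat) | i < #|chains|].

Definition entries x : 'X_{1..#|chains|} :=
  [multinom entry (enum_val i) x | i < #|chains|].

Lemma enum_chainsP (i : 'I_#|chains|) : maximal_chain (enum_val i).
Proof. by have := enum_valP i; rewrite inE. Qed.

Lemma enum_chains_chain (i : 'I_#|chains|) : is_chain (enum_val i).
Proof. by case/maxsetP: (enum_chainsP i). Qed.

Lemma atom_monomial_chain_labeling a :
  atom_monomial chain_labeling a = entries a.
Proof.
apply/mnmP=> i; rewrite /atom_monomial mnm_sumE mnmE /entry -[RHS]sum1_card.
under eq_bigr do rewrite mnmE.
by rewrite -big_mkcondr /=; apply: eq_bigl => p; rewrite inE andbC.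
Qed.

(** If x is not below y, the variable of a maximal chain through y has a larger
    exponent in entries x than in entries y. *)
Lemma entries_le x y : (entries x <= entries y)%MM = (x <= y)%O.
Proof.
apply/idP/idP => [|xy]; last by apply/mnm_lepP=> i; rewrite !mnmE entry_le.
apply: contraTT => xy; have [C mC yC] := maximal_chain_exists y.
have CI : C \in chains by rewrite inE.
apply/mnm_lepP => /(_ (enum_rank_in CI C)).
rewrite !mnmE enum_rankK_in // leqNgt entry_lt //.
by case/maxsetP: mC.
Qed.

Lemma entries_bot : entries \bot%O = 0%MM.
Proof. by apply/mnmP=> i; rewrite !mnmE entry_bot. Qed.

Lemma entries_join x y : entries (x `|` y)%O = mlcm (entries x) (entries y).
Proof. by apply/mnmP=> i; rewrite !mnmE entry_join // enum_chains_chain. Qed.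

Lemma labeling_ideal_chains :
  labeling_ideal (K := K) chain_labeling
    = monomial_ideal (K := K) [fset entries a | a in @atom d P]%fset.
Proof.
congr monomial_ideal; apply: eq_imfset => // a.
exact: atom_monomial_chain_labeling.
Qed.

Lemma chain_labeling_coordinatization :
  atomic P -> coordinatization K chain_labeling.
Proof.
move=> atP; exists [fset entries a | a in @atom d P]%fset.
  by rewrite labeling_ideal_chains; apply/atoms_minimal_generators/entries_le.
exact: (iso_lcms_atoms entries_le entries_bot entries_join atP).
Qed.

Lemma chain_labeling_strongly_generic :
  (forall C : {set P}, maximal_chain C ->
     {in @atom d P &, injective (entry C)}) ->
  strongly_generic (labeling_ideal (K := K) chain_labeling).
Proof.
move=> inj; exists [fset entries a | a in @atom d P]%fset.
  by rewrite labeling_ideal_chains; apply/atoms_minimal_generators/entries_le.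
move=> _ _ /imfsetP[a aa ->] /imfsetP[b ab ->] nab i _; apply: contraNneq nab.
by rewrite !mnmE => /(inj _ (enum_chainsP i) _ _ aa ab)->.
Qed.

End ChainLabeling.

(** * The criterion *)

Theorem theorem6p2 (K : fieldType) (d : Order.disp_t) (P : finTBLatticeType d)
    (n : nat) (s : n.-tuple P) (hP : in_L s) :
  (exists (k : nat) (M : P -> 'X_{1..k}), strongly_generic_coordinatization K M)
    <-> graded_of_rank P n.
Proof.
have [atP us sE] := hP.
have card_atoms : #|@atom d P| = n.
  by rewrite -(eq_card sE) (card_uniqP us) size_tuple.
rewrite -card_atoms; split=> [[k [M [[G mG [f [fle fG]]] [H mH sgH]]]] C mC|gr].
  rewrite -(minimal_generators_unique mG mH) in sgH.
  exact/maximal_chain_card/(strongly_generic_entry_inj fle fG sgH mC).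
exists _, (@chain_labeling d P); split.
  exact: chain_labeling_coordinatization.
by apply: chain_labeling_strongly_generic => C mC; apply/maximal_chain_card/gr.
Qed.
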